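(* Let $k>1$ be an integer and let $d=k^{2}+4$. Then all positive integer solutions $(x,y)$ of the equation $x^{2}-dy^{2}=1$ are given by $$(x,y)=\begin{cases}\left(\dfrac{V_{2n}(k,1)}{2},\dfrac{U_{2n}(k,1)}{2}\right) & \text{if } k \text{ is even},\\[2mm] \left(\dfrac{V_{6n}(k,1)}{2},\dfrac{U_{6n}(k,1)}{2}\right) & \text{if } k \text{ is odd},\end{cases}$$ with $n\geq 1$. That is, the set of pairs of positive integers solving the equation is exactly the set of these pairs as $n$ ranges over the integers $n\ge 1$.
   Context: For nonzero integers $k,s$ with $k^{2}+4s>0$, the generalized Fibonacci sequence is defined by $U_{0}(k,s)=0$, $U_{1}(k,s)=1$, $U_{n+1}(k,s)=kU_{n}(k,s)+sU_{n-1}(k,s)$ for $n\ge 1$, and the generalized Lucas sequence by $V_{0}(k,s)=2$, $V_{1}(k,s)=k$, $V_{n+1}(k,s)=kV_{n}(k,s)+sV_{n-1}(k,s)$ for $n\ge 1$. *)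

(* Defs.v *)
From HB Require Import structures.
From mathcomp Require Import all_boot all_order all_algebra.

Set Implicit Arguments.
Unset Strict Implicit.
Unset Printing Implicit Defensive.

Import Order.TTheory GRing.Theory Num.Theory.
Local Open Scope ring_scope.

(* Both sequences are total in k and s; the usual standing assumptions
   (k, s nonzero, k ^+ 2 + 4 * s > 0) are not needed to define them. *)
Fixpoint genFib (k s : int) (n : nat) : int :=
  match n with
  | 0%N => 0
  | m.+1 => match m with
            | 0%N => 1
            | l.+1 => k * genFib k s m + s * genFib k s l
            end
  end.

Fixpoint genLucas (k s : int) (n : nat) : int :=
  match n with
  | 0%N => 2
  | m.+1 => match m with
            | 0%N => k
            | l.+1 => k * genLucas k s m + s * genLucas k s l
            end
  end.

(* Main.v *)
Require Import Defs.
From HB Require Import structures.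
From mathcomp Require Import all_boot all_order all_algebra.
From mathcomp Require Import zify ring.

Set Implicit Arguments.
Unset Strict Implicit.
Unset Printing Implicit Defensive.

Import Order.TTheory GRing.Theory Num.Theory.
Local Open Scope ring_scope.

(** Write [U] and [V] for [genFib k 1] and [genLucas k 1].  A solution [(X, Y)]
    of [x ^ 2 - d y ^ 2 = 1] is a solution [(a, b) = (2 X, 2 Y)] of
    [a ^ 2 - d b ^ 2 = 4] with both entries even, and since [d = k ^ 2 + 4] the
    substitution [a = 2 c + k b] turns the latter equation into
    [b ^ 2 - k b c - c ^ 2 = -1].

    The form [b ^ 2 - k b c - c ^ 2] changes sign under the step
    [(b, c) -> (c, b - k c)], which runs the Fibonacci recurrence backwards.
    Descending along that step, the pairs with [b > 0] and [c >= 0] where the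
    form is [1] or [-1] all come from [(1, 0) = (U_1, U_0)], so they are the
    pairs [(U_{m+1}, U_m)] ([genFib_descent]), where the form is [(-1) ^ m]
    ([genFib_cassini]).  The value [-1] forces [m + 1] to be even, and
    [V_{m+1} = 2 U_m + k U_{m+1}] ([genLucas_genFib]) identifies [a].

    It remains to decide which [U_j] with [j] even are even.  Modulo 2 the
    sequence [U] is 0, 1, 0, 1, ... for [k] even and 0, 1, 1, 0, 1, 1, ... for
    [k] odd ([dvdz2_genFib]): for [k] even every even index qualifies, for [k]
    odd exactly the multiples of 6. *)

Lemma genFibSS (k s : int) n :
  genFib k s n.+2 = k * genFib k s n.+1 + s * genFib k s n.
Proof. by []. Qed.

Lemma genLucasSS (k s : int) n :
  genLucas k s n.+2 = k * genLucas k s n.+1 + s * genLucas k s n.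
Proof. by []. Qed.

Lemma genLucas_genFib (k s : int) n :
  genLucas k s n.+1 = 2 * s * genFib k s n + k * genFib k s n.+1.
Proof.
suff [] : genLucas k s n.+1 = 2 * s * genFib k s n + k * genFib k s n.+1 /\
  genLucas k s n.+2 = 2 * s * genFib k s n.+1 + k * genFib k s n.+2 by [].
elim: n => [|n [IH0 IH1]]; first by split=> /=; ring.
split=> //.
by rewrite genLucasSS IH1 IH0 !genFibSS; ring.
Qed.

Lemma genFib_cassini (k s : int) m :
  genFib k s m.+1 ^+ 2 - k * genFib k s m.+1 * genFib k s m
    - s * genFib k s m ^+ 2 = (- s) ^+ m.
Proof.
elim: m => [|m IH]; first by rewrite /=; ring.
by rewrite [(- s) ^+ m.+1]exprS -IH genFibSS; ring.
Qed.

Lemma genFib_gt0 (k s : int) n : 0 < k -> 0 < s -> 0 < genFib k s n.+1.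
Proof.
move=> k_gt0 s_gt0.
suff /andP[] : (0 < genFib k s n.+1) && (0 < genFib k s n.+2) by [].
elim: n => [|n /andP[IH0 IH1]]; first by rewrite /= mulr1 mulr0 addr0 k_gt0.
by rewrite IH1 genFibSS addr_gt0 ?mulr_gt0.
Qed.

(** Descent along [(b, c) -> (c, b - k c)], which decreases [b + c] and keeps
    the second entry nonnegative: [b < k c] with [c > 0] would bound the form by
    [b (b - k c) - c ^ 2 <= - b - c ^ 2 <= -2].  Both signs of the form are
    allowed because each step changes the sign. *)
Lemma genFib_descent (k b c : int) : 0 < k -> 0 < b -> 0 <= c ->
  `|b ^+ 2 - k * b * c - c ^+ 2| = 1 ->
  exists m, b = genFib k 1 m.+1 /\ c = genFib k 1 m.
Proof.
move=> k_gt0.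
have [N leN] : exists N : nat, b + c <= N%:Z by exists (absz (b + c)); lia.
elim: N b c leN => [|N IH] b c leN b_gt0 c_ge0 norm1; first by lia.
have [c0|c_neq0] := eqVneq c 0.
  by exists 0%N; split=> //=; move: norm1; rewrite c0; nia.
have c_gt0 : 0 < c by lia.
have r_ge0 : 0 <= b - k * c.
  rewrite leNgt; apply/negP => r_lt0.
  have : b * (b - k * c) <= - b by nia.
  have : 0 < c ^+ 2 by rewrite exprn_gt0.
  have form_eq : b ^+ 2 - k * b * c - c ^+ 2 = b * (b - k * c) - c ^+ 2.
    by ring.
  by move: norm1; rewrite form_eq; lia.
have [||m [c_eq r_eq]] := IH c (b - k * c) _ c_gt0 r_ge0.
- by nia.
- by rewrite -norm1 -[RHS]normrN; congr `|_|; ring.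
by exists m.+1; rewrite genFibSS -c_eq -r_eq; split=> //; ring.
Qed.

(** Since [V_j ^ 2 - d U_j ^ 2 = 4 (-1) ^ j], which is Cassini's identity
    rewritten, only the even indices [j] give [4]. *)
Lemma pell4_genLucas_genFib (k a b : int) : 0 < k ->
  [/\ 0 < a, 0 < b & a ^+ 2 - (k ^+ 2 + 4) * b ^+ 2 = 4] <->
  exists n, [/\ (0 < n)%N, a = genLucas k 1 (2 * n) & b = genFib k 1 (2 * n)].
Proof.
move=> k_gt0; split=> [[a_gt0 b_gt0 norm4]|[[|n] [// _ -> ->]]].
  (* a ^ 2 - (k b) ^ 2 = 4 (1 + b ^ 2) is even, hence so is a - k b. *)
  have [c a_eq] : exists c, a = 2 * c + k * b.
    have /dvdzP[c c_eq] : (2 %| a - k * b)%Z.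
      have : (2 %| (a - k * b) ^+ 2)%Z.
        apply/dvdzP; exists (2 * (1 + b ^+ 2) + k ^+ 2 * b ^+ 2 - a * k * b).
        have -> : (a - k * b) ^+ 2 =
          a ^+ 2 + k ^+ 2 * b ^+ 2 - 2 * a * k * b by ring.
        by lia.
      by rewrite !dvdzE /= abszX Euclid_dvdX //= andbT.
    by exists c; lia.
  have norm1 : b ^+ 2 - k * b * c - c ^+ 2 = - 1.
    by move: norm4; rewrite a_eq; lia.
  (* The same identity gives a > k b, so c, half of a - k b, is positive. *)
  have c_ge0 : 0 <= c.
    rewrite leNgt; apply/negP => c_lt0.
    have : a ^+ 2 <= (k * b) ^+ 2 by rewrite ler_sqr ?nnegrE; nia.
    by nia.
  have [|m [b_eq c_eq]] := @genFib_descent k b c k_gt0 b_gt0 c_ge0.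
    by rewrite norm1.
  have m_odd : odd m.
    move: (genFib_cassini k 1 m); rewrite mul1r -b_eq -c_eq norm1 -signr_odd.
    by case: odd.
  exists m.+1./2.
  have -> : (2 * m.+1./2 = m.+1)%N by lia.
  split=> //; first by lia.
  by rewrite genLucas_genFib -b_eq -c_eq a_eq mulr1.
have -> : (2 * n.+1 = (2 * n).+2)%N by lia.
have Um := genFib_gt0 (2 * n) k_gt0 (ltr01 : 0 < 1 :> int).
have USm := genFib_gt0 (2 * n).+1 k_gt0 (ltr01 : 0 < 1 :> int).
have := genFib_cassini k 1 (2 * n).+1.
rewrite -[(-1) ^+ _]signr_odd oddS oddM expr1 genLucas_genFib => norm1.
split=> //; first by rewrite addr_gt0 ?mulr_gt0.
by lia.
Qed.

Lemma dvdz2_genFib (k : int) n :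
  (2 %| genFib k 1 n)%Z = ((if (2 %| k)%Z then 2 else 3) %| n)%N.
Proof.
have par m : (2 %| genFib k 1 m.+2)%Z =
    ((2 %| genFib k 1 m)%Z == ((2 %| k)%Z || (2 %| genFib k 1 m.+1)%Z)).
  have -> : (2 %| k)%Z || (2 %| genFib k 1 m.+1)%Z =
      (2 %| k * genFib k 1 m.+1)%Z by rewrite !dvdzE abszM Euclid_dvdM.
  by rewrite genFibSS; lia.
suff [] : (2 %| genFib k 1 n)%Z = ((if (2 %| k)%Z then 2 else 3) %| n)%N /\
  (2 %| genFib k 1 n.+1)%Z = ((if (2 %| k)%Z then 2 else 3) %| n.+1)%N by [].
elim: n => [|n [IH0 IH1]]; first by case: ifP.
split=> //; rewrite par IH0 IH1.
by case: ifP => _; lia.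
Qed.

Lemma dvdz2_genLucas (k : int) n :
  (2 %| genFib k 1 n)%Z -> (2 %| genLucas k 1 n)%Z.
Proof.
case: n => [//|n] U_even.
by rewrite genLucas_genFib rpredD ?(dvdz_mull _ U_even) // -mulrA dvdz_mulr.
Qed.

(** Halving the solutions of the equation with right-hand side 4 is legitimate
    exactly when [U] is even, [V] being then even as well. *)
Lemma pell_genLucas_genFib (k x y : int) : 0 < k ->
  [/\ 0 < x, 0 < y & x ^+ 2 - (k ^+ 2 + 4) * y ^+ 2 = 1] <->
  exists n, [/\ (0 < n)%N, 2 * x = genLucas k 1 n & 2 * y = genFib k 1 n] /\
    ((if (2 %| k)%Z then 2 else 6) %| n)%N.
Proof.
move=> k_gt0; have := @pell4_genLucas_genFib k (2 * x) (2 * y) k_gt0.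
move=> [sol4 gen4]; split=> [[x_gt0 y_gt0 norm1]|].
  have [|n [n_gt0 Vn Un]] := sol4; first by split; lia.
  exists (2 * n)%N; split; first by split=> //; lia.
  have := dvdz2_genFib k (2 * n); rewrite -Un dvdz_mulr //.
  by case: ifP => _; lia.
move=> [n [[n_gt0 Vn Un] dvd_n]].
have n_eq : n = (2 * n./2)%N by case: ifP dvd_n => _; lia.
have [|x_gt0 y_gt0 norm4] := gen4.
  by exists n./2; rewrite -n_eq; split=> //; lia.
by split; lia.
Qed.

Theorem theorem7 (k d : int) (hk : 1 < k) (hd : d = k ^+ 2 + 4) (x y : rat) :
  [/\ x \is a Num.int, y \is a Num.int, 0 < x, 0 < y
    & x ^+ 2 - d%:Q * y ^+ 2 = 1] <->
  exists n : nat, (1 <= n)%N /\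
    (x, y) = if (2 %| k)%Z
             then ((genLucas k 1 (2 * n))%:Q / 2, (genFib k 1 (2 * n))%:Q / 2)
             else ((genLucas k 1 (6 * n))%:Q / 2, (genFib k 1 (6 * n))%:Q / 2).
Proof.
have k_gt0 : 0 < k by lia.
set p := (if (2 %| k)%Z then 2 else 6)%N.
have halfK (z : int) : z%:Q = (2 * z)%:Q / 2 by rewrite intrM; field.
have pairE n : (if (2 %| k)%Z
    then ((genLucas k 1 (2 * n))%:Q / 2, (genFib k 1 (2 * n))%:Q / 2)
    else ((genLucas k 1 (6 * n))%:Q / 2, (genFib k 1 (6 * n))%:Q / 2)) =
  ((genLucas k 1 (p * n))%:Q / 2, (genFib k 1 (p * n))%:Q / 2).
  by rewrite /p; case: ifP.
have normE (X Y : int) : (X%:Q ^+ 2 - d%:Q * Y%:Q ^+ 2 = 1) <->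
    (X ^+ 2 - (k ^+ 2 + 4) * Y ^+ 2 = 1).
  rewrite -hd -!rmorphXn -rmorphM -rmorphB /=.
  by split=> [/(@intr_inj rat _ 1)|->].
have p_gt0 : (0 < p)%N by rewrite /p; case: ifP.
split=> [[/intrP[X ->] /intrP[Y ->]]|[n [n_gt0]]].
  rewrite !ltr0z => X_gt0 Y_gt0 /normE norm1.
  have [sol _] := @pell_genLucas_genFib k X Y k_gt0.
  have [//|n [[n_gt0 Vn Un] /dvdnP[q n_eq]]] := sol.
  exists q; split; first by move: n_gt0; rewrite n_eq; case: (q).
  by rewrite pairE mulnC -n_eq -Vn -Un -!halfK.
rewrite pairE => -[-> ->].
have U_even : (2 %| genFib k 1 (p * n))%Z.
  by rewrite dvdz2_genFib /p dvdn_mulr //; case: ifP.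
have /dvdzP[X V_eq] := dvdz2_genLucas U_even.
have /dvdzP[Y U_eq] := U_even.
have [_ gen] := @pell_genLucas_genFib k X Y k_gt0.
have [|X_gt0 Y_gt0 norm1] := gen.
  exists (p * n)%N; rewrite V_eq U_eq mulrC [2 * Y]mulrC dvdn_mulr //.
  by rewrite muln_gt0 p_gt0.
rewrite V_eq U_eq (mulrC X) (mulrC Y) -!halfK !ltr0z.
by split; rewrite ?intr_int //; apply/normE.
Qed.
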